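(* Let $(y_n)_{n\ge 1}$ be a nondecreasing sequence of positive integers with output array $A(n,k)$. Let $k\ge 0$ and let $N\ge1$ be an integer such that $k\le y_{N+1}$. Then for every integer $n\ge 2$, $$A(N+n-1,k)=\binom{n+k-2}{k}+\sum_{j=1}^{k}\binom{n+k-2-j}{k-j}A(N,j).$$
   Context: Let $(y_n)_{n\ge1}$ be a nondecreasing sequence of positive integers (an input sequence). For a positive integer $n$, an $n$-tuple $\mathbf{x}=(x_1,\dots,x_n)$ of nonnegative integers is called valid for $(y_n)$ if $x_1\le y_n$ and $x_{j+1}\le \min(x_j,y_{n-j})$ for $1\le j\le n-1$. For $n\ge1$ and $k\ge0$, $A(n,k)$ denotes the number of valid $n$-tuples with $x_1=k$; the array $(A(n,k))$ is the output array of $(y_n)$. *)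

(* Defs.v *)
From mathcomp Require Import all_boot.

Set Implicit Arguments.
Unset Strict Implicit.
Unset Printing Implicit Defensive.

(* A sequence (y_n)_{n >= 1} is a function on nat whose value at 0 is ignored. *)
Definition input_sequence (y : nat -> nat) : Prop :=
  (forall i, 1 <= i -> 0 < y i) /\
  (forall i j, 1 <= i -> i <= j -> y i <= y j).

(* Tuples are 0-based: the entry x_(j+1) of (x_1, ..., x_n) is nth 0 x j. *)
Definition valid (y : nat -> nat) (n : nat) (x : n.-tuple nat) : bool :=
  (nth 0 x 0 <= y n) &&
  [forall j : 'I_n, (1 <= j) ==>
     (nth 0 x j <= minn (nth 0 x j.-1) (y (n - j)))].

(* Valid tuples are nonincreasing with first entry at most y n, so counting
   them among the tuples with entries in {0, ..., y n} loses none: see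
   output_arrayE. Only n >= 1 is meaningful. *)
Definition output_array (y : nat -> nat) (n k : nat) : nat :=
  #|[set x : n.-tuple 'I_(y n).+1 |
      valid y [tuple of map val x] & nth 0 (map val x) 0 == k]|.

Lemma valid_le (y : nat -> nat) (n : nat) (x : n.-tuple nat) (a : nat) :
  valid y x -> a \in tval x -> a <= y n.
Proof.
case/andP=> x0 /forallP xS /(nthP 0)[i]; rewrite size_tuple => + <-.
elim: i => [//|i IHi] lti.
have := xS (Ordinal lti); rewrite /= leq_min => /andP[le_i _].
exact: leq_trans le_i (IHi (ltnW lti)).
Qed.

Lemma output_arrayE (y : nat -> nat) (n k : nat) (s : seq (n.-tuple nat)) :
  uniq s -> (forall x, (x \in s) = valid y x && (nth 0 x 0 == k)) ->
  output_array y n k = size s.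
Proof.
move=> s_uniq sP; rewrite /output_array.
pose f (x : n.-tuple 'I_(y n).+1) : n.-tuple nat := [tuple of map val x].
have f_inj : injective f.
  by move=> u v /(congr1 val) /= /(inj_map val_inj) /val_inj.
rewrite cardE -(size_map f); apply/perm_size/uniq_perm => //.
  by rewrite (map_inj_uniq f_inj) enum_uniq.
move=> x; rewrite sP; apply/mapP/idP => [[u]|].
  by rewrite mem_enum inE => uP ->.
move=> xP; have fx : f [tuple of map (@inord (y n)) x] = x.
  apply/val_inj; rewrite /= -map_comp -[RHS]map_id; apply/eq_in_map => a ax /=.
  by rewrite inordK // ltnS; case/andP: xP => xv _; apply: valid_le ax.
exists [tuple of map (@inord (y n)) x] => //.
rewrite mem_enum inE -[[seq val _ | _ <- _]]/(tval (f _)).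
by rewrite -[[tuple of tval _]]/(f _) fx.
Qed.

(* Main.v *)
Require Import Defs.
From mathcomp Require Import all_boot.

(** Deleting the first entry of a valid tuple gives the row recurrence
    A(n+1,k) = A(n,0) + ... + A(n,k) for k <= y_(n+1), hence the Pascal-type
    rule A(n+1,k+1) = A(n+1,k) + A(n,k+1). Since y is nondecreasing, both hold in
    every row beyond N for columns up to y_(N+1); as A(N,0) = 1, the right-hand
    side is the sum over 0 <= j <= k of C(n+k-2-j,k-j) A(N,j), which obeys the
    same rule by Pascal's identity. *)

Lemma valid_cons (y : nat -> nat) (n a : nat) (x : n.-tuple nat) :
  valid y [tuple of a :: x] =
  [&& a <= y n.+1, nth 0 x 0 <= a & valid y x].
Proof.
apply/andP/and3P => [[/= le_a /forallP xS]|[le_a le_x /andP[le_xy /forallP xS]]].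
  case: n => [|n] in x le_a xS *; first by split; rewrite ?tuple0 ?/valid //=;
    apply/forallP; case.
  (* The condition at position 1 yields both that the head of [x] is at most [a] and that it is at
     most [y n.+1], the bound on the head in its own row. *)
  have := xS (Ordinal (isT : 1 < n.+2)).
  rewrite /= subSS subn0 leq_min => /andP[le_xa le_xy].
  split=> //; apply/andP; split=> //; apply/forallP=> j.
  apply/implyP=> j_gt0; have := xS (lift ord0 j).
  by rewrite lift0 /= subSS; case: (nat_of_ord j) j_gt0.
split=> //; apply/forallP=> -[[|[|j]] //= ltj].
  by rewrite subSS subn0 leq_min le_x.
by have := xS (Ordinal (ltj : j.+1 < n)); rewrite /= subSS.
Qed.

(** An explicit list to feed to [output_arrayE]; bounding the entries by [y n] makes the enumeration
    finite. *)
Definition valid_tuples (y : nat -> nat) (n k : nat) : seq (n.-tuple nat) :=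
  [seq x <- [seq map_tuple val u | u <- enum {: n.-tuple 'I_(y n).+1}]
     | valid y x & nth 0 x 0 == k].

Lemma mem_valid_tuples (y : nat -> nat) (n k : nat) (x : n.-tuple nat) :
  (x \in valid_tuples y n k) = valid y x && (nth 0 x 0 == k).
Proof.
rewrite mem_filter; case: (boolP (valid y x && _)) => //= /andP[xv _].
apply/mapP; exists [tuple of map (@inord (y n)) x]; first by rewrite mem_enum.
apply/val_inj; rewrite /= -map_comp -[LHS]map_id; apply/eq_in_map => a ax /=.
by rewrite inordK // ltnS; apply: valid_le ax.
Qed.

Lemma valid_tuples_uniq (y : nat -> nat) (n k : nat) :
  uniq (valid_tuples y n k).
Proof.
rewrite filter_uniq // map_inj_uniq ?enum_uniq // => u v /(congr1 val) /=.
by move=> /(inj_map val_inj) /val_inj.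
Qed.

Lemma size_valid_tuples (y : nat -> nat) (n k : nat) :
  size (valid_tuples y n k) = output_array y n k.
Proof.
by rewrite (output_arrayE (valid_tuples_uniq y n k)) // => x;
  apply: mem_valid_tuples.
Qed.

Lemma output_array_rec (y : nat -> nat) (n k : nat) : k <= y n.+1 ->
  output_array y n.+1 k = \sum_(0 <= j < k.+1) output_array y n j.
Proof.
move=> le_k.
pose s := [seq [tuple of k :: tval x] | j <- iota 0 k.+1, x <- valid_tuples y n j].
rewrite (@output_arrayE y n.+1 k s).
- rewrite size_allpairs_dep sumnE big_map /index_iota subn0.
  by apply: eq_bigr => j _; rewrite size_valid_tuples.
- apply: allpairs_uniq_dep => [||p q]; first exact: iota_uniq.
    by move=> j _; apply: valid_tuples_uniq.
  (* The index is recovered from the tail as its first entry, so equal tuples come from equal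
     pairs. *)
  move=> /allpairsPdep[i [u [_ + ->]]] /allpairsPdep[j [v [_ + ->]]] /=.
  rewrite !mem_valid_tuples => /andP[_ /eqP <-] /andP[_ /eqP <-].
  by move=> [/val_inj ->].
- move=> x; case/tupleP: x => a x; rewrite valid_cons /=.
  apply/allpairsPdep/andP => [[j [u [jk + /(congr1 val) [-> /val_inj ->]]]]|].
    rewrite mem_valid_tuples => /andP[-> /eqP ->]; rewrite mem_iota ltnS in jk.
    by rewrite le_k eqxx !andbT.
  case=> /and3P[_ le_x xv] /eqP eq_a; exists (nth 0 x 0), x.
  rewrite mem_iota mem_valid_tuples xv eqxx add0n ltnS -eq_a le_x.
  by split=> //; apply/val_inj; rewrite /= eq_a.
Qed.

(** The induction can start at row 0: the empty tuple has default first entry 0. *)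
Lemma output_array0 (y : nat -> nat) (n : nat) : output_array y n 0 = 1.
Proof.
elim: n => [|n IHn]; last by rewrite output_array_rec // big_nat1.
apply: (@output_arrayE y 0 0 [:: [tuple]]) => // x.
rewrite tuple0 inE eqxx /valid /=; apply/esym/andP; split=> //.
by apply/forallP; case.
Qed.

Lemma output_array_pascal (y : nat -> nat) (n k : nat) : k < y n.+1 ->
  output_array y n.+1 k.+1 = output_array y n.+1 k + output_array y n k.+1.
Proof. by move=> lt_k; rewrite !output_array_rec ?big_nat_recr // ltnW. Qed.

(** Here [m] stands for n-2. The bound on [k] in all later rows passes to smaller columns, as the
    inner induction on [k] requires. *)
Lemma output_array_conv (y : nat -> nat) (N m k : nat) :
  (forall i, k <= y (N + i).+1) ->
  output_array y (N + m).+1 k =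
    \sum_(0 <= j < k.+1) 'C(m + (k - j), k - j) * output_array y N j.
Proof.
elim: m k => [|m IHm] k.
  move/(_ 0); rewrite addn0 => le_k; rewrite output_array_rec //.
  by apply: eq_bigr => j _; rewrite binn mul1n.
elim: k => [|k IHk] le_k; first by rewrite big_nat1 !output_array0 bin0.
rewrite output_array_pascal // addnS IHm // -addnS IHk; last first.
  by move=> i; apply/ltnW/le_k.
(* The terms j = k+1 agree, both with coefficient 1; for j <= k the coefficients add up by Pascal's
   identity. *)
rewrite [in RHS]big_nat_recr // [X in _ + X]big_nat_recr //= !subnn !bin0 addnA.
congr (_ + _); rewrite -big_split /=; apply: eq_big_nat => j lt_j.
by rewrite -mulnDl subSn // !addnS !addSn [in RHS]binS addnC.
Qed.

Theorem theorem3p1 (y : nat -> nat) (hy : input_sequence y)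
  (k N : nat) (hN : 1 <= N) (hk : k <= y N.+1) (n : nat) (hn : 2 <= n) :
  output_array y (N + n - 1) k =
    'C(n + k - 2, k)
    + \sum_(1 <= j < k.+1) 'C(n + k - 2 - j, k - j) * output_array y N j.
Proof.
(* Writing n = m+2 removes the truncated subtractions of 1 and 2. *)
case: n hn => [|[|m]] // _; rewrite !addSn !addnS !subSS !subn0.
rewrite output_array_conv => [|i]; last first.
  by apply: leq_trans hk (hy.2 _ _ _ _); rewrite // ltnS leq_addr.
rewrite big_nat_recl // output_array0 subn0 muln1 big_add1 /=.
by congr (_ + _); apply: eq_big_nat => j lt_j; rewrite addnBA.
Qed.
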